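(* For all positive integers $n$, $$ \mathrm{PL}(n)=\frac{B_{n}\bigl(0!\,\sigma_{2}(1),\,1!\,\sigma_{2}(2),\,\ldots,\,(n-1)!\,\sigma_{2}(n)\bigr)}{n!}, $$ where $\mathrm{PL}(n)$ is the number of plane partitions of $n$, $B_n$ is the $n$th complete Bell polynomial (evaluated with $i$th argument $(i-1)!\,\sigma_2(i)$ for $1\le i\le n$), and $\sigma_{2}(n)=\sum_{d\mid n}d^{2}$ is the sum of the squares of the positive divisors of $n$.
   Context: A plane partition of $n$ is a two-dimensional array of non-negative integers $n_{i,j}$ ($i,j\ge 1$) that is non-increasing in both indices, that is, $n_{i,j}\ge n_{i,j+1}$ and $n_{i,j}\ge n_{i+1,j}$ for all $i,j$, and satisfies $\sum_{i,j}n_{i,j}=n$. $\mathrm{PL}(n)$ denotes the number of plane partitions of $n$; for example $\mathrm{PL}(3)=6$. For non-negative integers $n,l$, the partial Bell polynomial is $$ B_{n,l}(x_1,\ldots,x_{n-l+1})=\sum \frac{n!}{\prod_{i=1}^{n-l+1}\ell_i!}\prod_{i=1}^{n-l+1}\Bigl(\frac{x_i}{i!}\Bigr)^{\ell_i}, $$ the sum running over all sequences of non-negative integers $\ell_i$ with $\sum_i i\,\ell_i=n$ and $\sum_i \ell_i=l$. In particular $B_{0,0}=1$ and $B_{n,0}=0$ for $n\ge1$. The $n$th complete Bell polynomial is $$ B_n(x_1,\ldots,x_n)=\sum_{l=0}^{n}B_{n,l}(x_1,\ldots,x_{n-l+1}). $$ *)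

(* Defs.v *)
From mathcomp Require Import all_boot all_order all_algebra finmap.
From mathcomp Require Import boolp classical_sets functions cardinality fsbigop.

Set Implicit Arguments.
Unset Strict Implicit.
Unset Printing Implicit Defensive.

Import GRing.Theory Num.Theory.
Local Open Scope ring_scope.

(* The entry n_{i,j} (i, j >= 1) of the array is [a i.-1 j.-1].  An infinite
   array of naturals with a finite sum has finite support; this is required
   explicitly because [\sum_(p \in _)] is 0 by convention on infinite supports,
   which would otherwise matter for n = 0. *)
Definition plane_partition (n : nat) (a : nat -> nat -> nat) : Prop :=
  [/\ forall i j, (a i j.+1 <= a i j)%N,
      forall i j, (a i.+1 j <= a i j)%N,
      finite_set [set p : nat * nat | a p.1 p.2 <> 0%N]%classic &
      \sum_(p \in [set: nat * nat]%classic) a p.1 p.2 = n].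

(* [fset_set] returns the empty set on infinite sets, but there are only
   finitely many plane partitions of a given n. *)
Definition PL (n : nat) : nat :=
  #|` fset_set [set a | plane_partition n a]%classic |%fset.

Definition sigma (k m : nat) : nat := (\sum_(d <- divisors m) d ^ k)%N.

(* B_{n,l}(x 1, ..., x (n-l+1)).  The multiplicity of the part i.+1 is [m i],
   for i < n-l+1.  Restricting multiplicities to values <= l is harmless, since
   they sum to l.  If l > n, then [(n - l).+1] is 1 and the sum is empty. *)
Definition partial_bell (F : numFieldType) (n l : nat) (x : nat -> F) : F :=
  \sum_(m : {ffun 'I_(n - l).+1 -> 'I_l.+1} |
          ((\sum_(i < (n - l).+1) i.+1 * m i)%N == n) &&
          ((\sum_(i < (n - l).+1) m i)%N == l))
     n`!%:R / (\prod_(i < (n - l).+1) (m i)`!%:R)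
     * \prod_(i < (n - l).+1) (x i.+1 / (i.+1)`!%:R) ^+ m i.

Definition complete_bell (F : numFieldType) (n : nat) (x : nat -> F) : F :=
  \sum_(0 <= l < n.+1) partial_bell n l x.

(* Main.v *)
Require Import Defs.
From mathcomp Require Import all_boot all_order all_algebra finmap.
From mathcomp Require Import boolp classical_sets functions cardinality fsbigop.
From mathcomp Require Import zify ring.

(** The generating function of plane partitions is MacMahon's product
    prod_(h >= 1) (1 - X^h)^(-h), while complete_bell n x / n! is the
    coefficient of X^n in exp (sum_(i >= 1) x_i X^i / i!), here with
    x_i / i! = sigma_2(i) / i.  Both series have constant term 1, and in both
    the operator A |-> X A' / A gives sum_(k >= 1) sigma_2(k) X^k: a factor
    1 / (1 - X^h) contributes h (X^h + X^(2h) + ...), so its h copies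
    contribute h^2 to the coefficient of X^k exactly when h divides k.
    A series is determined by its constant term and its logarithmic derivative
    ([logder_unique]), hence the two agree.

    MacMahon's formula is the substantial ingredient.  The diagonals of a plane
    partition form a main diagonal lam and two chains of partitions that
    descend from lam to the empty partition, successive members being
    interlaced ([PL_card]); its size is the sum of the weights of all
    diagonals.  So the generating function is a sum over lam of a product of
    two chain generating functions, a specialised Cauchy sum
    sum_lam s_lam(x) s_lam(y) of Schur functions.  It is evaluated by the local
    rule [sum_toggle]: given mu and nu, the partitions lam interlaced above
    both correspond to the pairs of a number m and a partition kap interlaced
    below both, by lam_0 = max(mu_0, nu_0) + m and
      lam_(i+1) + kap_i = max(mu_(i+1), nu_(i+1)) + min(mu_i, nu_i),
    and then |lam| + |kap| = |mu| + |nu| + m.  Applied along a whole chain, the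
    rule replaces lam by a member mu of the other chain at the price of
    geometric series ([sum_chain_gf]); doing so for each member of that chain
    yields prod_(k, j) 1 / (1 - X^(k+j+1)) ([cauchy]), in which the exponent h
    occurs h times.

    Series are represented by polynomials considered modulo X^(N+1), for some
    N > n.  This keeps every sum finite: partitions range over arrays of N + 1
    numbers that are at most N, and whatever this truncation loses has weight
    greater than N. *)

Set Implicit Arguments.
Unset Strict Implicit.
Unset Printing Implicit Defensive.

Import Order.TTheory GRing.Theory Num.Theory.
Local Open Scope ring_scope.

(** * Power series modulo a power of X *)

Definition eqmodX (R : nzSemiRingType) (N : nat) (p q : {poly R}) :=
  forall k, (k <= N)%N -> p`_k = q`_k.

Notation "p =X q %[ N ]" := (eqmodX N p q)
  (at level 70, q at next level, format "p  =X  q  %[ N ]").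

Section EqmodX.
Variables (R : comNzRingType) (N : nat).
Implicit Types p q r : {poly R}.

Lemma eqmodX_refl p : p =X p %[N]. Proof. by []. Qed.

Lemma eqmodX_sym p q : p =X q %[N] -> q =X p %[N].
Proof. by move=> pq k kN; rewrite pq. Qed.

Lemma eqmodX_trans q p r : p =X q %[N] -> q =X r %[N] -> p =X r %[N].
Proof. by move=> pq qr k kN; rewrite pq ?qr. Qed.

Lemma eqmodXD p q p' q' :
  p =X q %[N] -> p' =X q' %[N] -> p + p' =X q + q' %[N].
Proof. by move=> pq pq' k kN; rewrite !coefD pq ?pq'. Qed.

Lemma eqmodXM p q p' q' :
  p =X q %[N] -> p' =X q' %[N] -> p * p' =X q * q' %[N].
Proof.
move=> pq pq' k kN; rewrite !coefM; apply: eq_bigr => i _.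
by rewrite pq ?pq' //; have := ltn_ord i; lia.
Qed.

Lemma eqmodXMl r p q : p =X q %[N] -> r * p =X r * q %[N].
Proof. exact/eqmodXM/eqmodX_refl. Qed.

Lemma eqmodXMr r p q : p =X q %[N] -> p * r =X q * r %[N].
Proof. by move=> pq; apply: eqmodXM. Qed.

Lemma eqmodX_sum I (s : seq I) (P : pred I) (F G : I -> {poly R}) :
  (forall i, P i -> F i =X G i %[N]) ->
  \sum_(i <- s | P i) F i =X \sum_(i <- s | P i) G i %[N].
Proof. by move=> FG k kN; rewrite !coef_sum; apply: eq_bigr => i /FG ->. Qed.

(** Monomials of degree above [N] may be dropped or added at will; this is what
    allows a bijection that is only valid on small weights. *)
Lemma eqmodX_trunc I (s : seq I) (P : pred I) (e : I -> nat) :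
  \sum_(i <- s | P i) 'X^(e i)
    =X \sum_(i <- s | P i && (e i <= N)%N) 'X^(e i) :> {poly R} %[N].
Proof.
move=> k kN; rewrite !coef_sum [RHS]big_mkcondr /=; apply: eq_bigr => i _.
by case: ifP => // eN; rewrite coefXn; case: eqP => // kE; lia.
Qed.

Lemma coefXderiv p k : ('X * p^`())`_k = p`_k *+ k.
Proof. by rewrite coefXM; case: k => //= k; rewrite coef_deriv. Qed.

Lemma eqmodX_Xderiv p q : p =X q %[N] -> 'X * p^`() =X 'X * q^`() %[N].
Proof. by move=> pq k kN; rewrite !coefXderiv pq. Qed.

End EqmodX.

(** [L] plays the part of X A' / A, stated without division. *)
Definition logder (R : nzRingType) (N : nat) (A L : {poly R}) :=
  A`_0 = 1 /\ 'X * A^`() =X L * A %[N].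

Section LogDer.
Variables (R : comNzRingType) (N : nat).
Implicit Types A B L M : {poly R}.

Lemma logder1 : logder N 1 (0 : {poly R}).
Proof. by split; rewrite ?coef1 // derivC mulr0 mul0r. Qed.

Lemma logderM A B L M :
  logder N A L -> logder N B M -> logder N (A * B) (L + M).
Proof.
move=> [A0 AL] [B0 BM]; split; first by rewrite coefM big_ord1 A0 B0 mulr1.
rewrite derivM mulrDr mulrDl; apply: eqmodXD.
  by rewrite mulrA [L * _]mulrA; apply: eqmodXMr.
by rewrite !mulrA ['X * A]mulrC [M * A]mulrC -!mulrA; apply: eqmodXMl.
Qed.

Lemma logder_prod I (s : seq I) (P : pred I) (F G : I -> {poly R}) :
  (forall i, P i -> logder N (F i) (G i)) ->
  logder N (\prod_(i <- s | P i) F i) (\sum_(i <- s | P i) G i).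
Proof.
move=> FG; elim/big_rec2: _ => [|i L A Pi AL]; first exact: logder1.
exact/logderM/AL/FG.
Qed.
End LogDer.

(** The coefficients of [A] satisfy k A_k = sum_(0 < i <= k) L_i A_(k-i), a
    recursion because L_0 = 0, and k can be cancelled in characteristic 0. *)
Lemma logder_unique (R : numFieldType) N (A B L M : {poly R}) :
  logder N A L -> logder N B M -> L =X M %[N] -> A =X B %[N].
Proof.
move=> [A0 AL] [B0 BM] LM k; have [m] := ubnP k.
elim: m k => // m IHm [_ _|k km kN]; first by rewrite A0 B0.
have L0 : L`_0 = 0.
  by have := AL 0%N isT; rewrite coefXderiv coefM big_ord1 A0 mulr1.
have M0 : M`_0 = 0 by rewrite -LM.
apply: (@pmulrnI R k.+1) => //; rewrite -!coefXderiv AL // BM //.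
rewrite !coefM !(big_ord_recl k.+1) /= L0 M0 !mul0r !add0r.
apply: eq_bigr => i _; rewrite LM ?IHm //= /bump /=; have := ltn_ord i; lia.
Qed.

(** The truncation of 1 / (1 - X^h). *)
Definition geo (R : nzRingType) (N h : nat) : {poly R} :=
  \sum_(j < N.+1) 'X^(h * j).

Lemma coef_geo (R : nzRingType) N h k : (0 < h)%N -> (k <= N)%N ->
  (geo R N h)`_k = (h %| k)%N%:R.
Proof.
move=> h0 kN; rewrite coef_sum; have [/dvdnP[j kE]|hk] := boolP (h %| k)%N.
  have jN : (j < N.+1)%N by nia.
  rewrite kE (bigD1 (Ordinal jN)) //= coefXn mulnC eqxx big1 ?addr0 // => i.
  by rewrite -val_eqE /= coefXn eqn_pmul2l // eq_sym => /negPf ->.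
rewrite big1 // => i _; rewrite coefXn; case: eqP hk => // ->.
by rewrite dvdn_mulr.
Qed.

(** Differentiating (1 - X^h) G = 1 gives (1 - X^h) X G' = h X^h G, and
    multiplying by G, the inverse of 1 - X^h, isolates X G'. *)
Lemma logder_geo (R : comNzRingType) N h : (0 < h)%N ->
  logder N (geo R N h) ('X^h *+ h * geo R N h).
Proof.
move=> h0; split; first by rewrite coef_geo // dvdn0.
set G := geo R N h.
have PG : (1 - 'X^h) * G =X 1 %[N].
  move=> k kN; rewrite mulrBl mul1r coefB coefXnM coef1 coef_geo //.
  case: ltnP => kh.
    rewrite subr0; case: k kh {kN} => [|k] kh; first by rewrite dvdn0.
    by rewrite gtnNdvd.
  rewrite coef_geo //; last by lia.
  by rewrite dvdn_subl ?dvdnn // subrr gtn_eqF // (leq_trans h0).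
have /eqmodX_Xderiv := PG.
rewrite derivM derivB derivXn derivC sub0r mulr0 => E.
have XX : 'X * 'X^(h.-1) = 'X^h :> {poly R} by rewrite -exprS prednK.
have E1 : (1 - 'X^h) * ('X * G^`()) =X 'X^h *+ h * G %[N].
  move=> k kN; apply: subr0_eq; rewrite -coefB.
  apply: etrans (etrans (E k kN) (coef0 _ k)).
  by rewrite mulrDr mulrA mulrN mulrnAr XX mulNr mulrCA addrC.
apply: eqmodX_trans (_ : G * ((1 - 'X^h) * ('X * G^`())) =X _ %[N]).
  rewrite mulrA [G * _]mulrC -[X in X =X _ %[_]]mul1r.
  exact/eqmodXMr/eqmodX_sym.
rewrite [X in _ =X X %[_]]mulrC.
exact: eqmodXMl.
Qed.

Lemma coef_dlog_geo (R : comNzRingType) N h k : (0 < h)%N -> (0 < k <= N)%N ->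
  ('X^h *+ h * geo R N h)`_k = ((h %| k) * h)%N%:R.
Proof.
move=> h0 /andP[k0 kN]; rewrite mulrnAl coefMn coefXnM.
case: ltnP => [kh|hk]; first by rewrite gtnNdvd // mul0n mul0rn.
by rewrite coef_geo ?dvdn_subl // ?natrM ?mulr_natr // (leq_trans (leq_subr _ _)).
Qed.

(** The truncation of exp (a X^i). *)
Definition expo (R : unitRingType) (N i : nat) (a : R) : {poly R} :=
  \sum_(j < N.+1) (a ^+ j / j`!%:R) *: 'X^(i * j).

Lemma logder_expo (R : numFieldType) N i (a : R) : (0 < i)%N ->
  logder N (expo N i a) ((i%:R * a) *: 'X^i).
Proof.
move=> i0; split.
  rewrite coef_sum big_ord_recl big1 => [|j _]; rewrite coefZ coefXn.
    by rewrite muln0 eqxx fact0 expr0 invr1 !mulr1 addr0.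
  by rewrite /= /bump /= ltn_eqF ?mulr0 // muln_gt0 i0.
have -> : 'X * (expo N i a)^`() =
    \sum_(j < N) ((i%:R * a) * (a ^+ j / j`!%:R)) *: 'X^(i * j.+1).
  rewrite (raddf_sum (@deriv R)) mulr_sumr big_ord_recl /= muln0.
  rewrite derivZ derivXn mulr0n scaler0 mulr0 add0r; apply: eq_bigr => j _.
  rewrite derivZ derivXn -scalerAr mulrnAr -exprS prednK ?muln_gt0 ?i0 //.
  rewrite -[_ *+ (i * _)]scaler_nat scalerA /= /bump /= add1n.
  congr (_ *: _); rewrite factS !natrM exprS.
  have f0 : j`!%:R != 0 :> R by rewrite pnatr_eq0 -lt0n fact_gt0.
  have j0 : j.+1%:R != 0 :> R by rewrite pnatr_eq0.
  rewrite invfM.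
  by move: (j.+1%:R) (j`!%:R) j0 f0 => u v u0 v0; field; rewrite u0 v0.
move=> k kN; rewrite /expo big_ord_recr /= mulrDr mulr_sumr coefD.
rewrite -scalerAl -scalerAr !scalerA -exprD coefZ coefXn.
have /negPf -> : k != (i + i * N)%N by nia.
rewrite mulr0 addr0; congr (polyseq _)`_k; apply: eq_bigr => j _.
by rewrite -scalerAl -scalerAr scalerA -exprD mulnS.
Qed.

(** * Finite functions as sequences of naturals *)

(** Extending a finite function by 0 lets functions with different domains be
    compared, and lets neighbouring entries [i] and [i.+1] be spoken of without
    a special case at the last index. *)
Definition entry (k b : nat) (f : {ffun 'I_k -> 'I_b}) (i : nat) : nat :=
  oapp (fun o => nat_of_ord (f o)) 0%N (insub i).

Definition of_entries (k b : nat) (g : nat -> nat) : {ffun 'I_k -> 'I_b.+1} :=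
  [ffun i : 'I_k => inord (g i)].

Section Entry.
Variables k b : nat.
Implicit Types f : {ffun 'I_k -> 'I_b.+1}.

Lemma entryE f (i : 'I_k) : entry f i = f i.
Proof. by rewrite /entry valK. Qed.

Lemma entry_out f i : (k <= i)%N -> entry f i = 0%N.
Proof. by move=> ki; rewrite /entry insubF // ltnNge ki. Qed.

Lemma entry_le f i : (entry f i <= b)%N.
Proof. by rewrite /entry; case: insub => //= o; rewrite -ltnS. Qed.

Lemma entry_inj f f' : entry f =1 entry f' -> f = f'.
Proof. by move=> ff'; apply/ffunP => i; apply: val_inj; rewrite /= -!entryE. Qed.

Lemma entry_of_entries g i :
  (i < k)%N -> (g i <= b)%N -> entry (of_entries k b g) i = g i.
Proof.
by move=> ik gb; rewrite -[i]/(val (Ordinal ik)) entryE ffunE inordK.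
Qed.

Lemma of_entries_supp g i : (forall j, (g j <= b)%N) ->
  (forall j, (k <= j)%N -> g j = 0%N) -> entry (of_entries k b g) i = g i.
Proof.
move=> gb gk; have [ik|ki] := ltnP i k; first exact: entry_of_entries.
by rewrite entry_out ?gk.
Qed.

Lemma big_entry (R : Type) (idx : R) (op : Monoid.law idx) f d
    (F : nat -> nat -> R) :
  (d <= k)%N -> (forall i, (d <= i)%N -> entry f i = 0%N) ->
  (forall i, F i 0%N = idx) ->
  \big[op/idx]_(i < k) F i (f i) = \big[op/idx]_(0 <= i < d) F i (entry f i).
Proof.
move=> dk fd F0.
rewrite (eq_bigr (fun i : 'I_k => F i (entry f i))) => [|i _]; last first.
  by rewrite entryE.
rewrite -(big_mkord xpredT (fun i => F i (entry f i))).
rewrite (big_cat_nat _ dk) //=.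
have -> : \big[op/idx]_(d <= i < k) F i (entry f i) = idx.
  by rewrite big_nat_cond big1 // => i /andP[/andP[di _] _]; rewrite fd.
by rewrite Monoid.mulm1.
Qed.

End Entry.

(** * Complete Bell polynomials as coefficients of an exponential *)

Section Multiplicities.
Variables n l : nat.

Definition bell_index k b (f : {ffun 'I_k -> 'I_b.+1}) :=
  ((\sum_(i < k) i.+1 * f i)%N == n) && ((\sum_(i < k) f i)%N == l).

Section Props.
Variables k b : nat.
Implicit Types f : {ffun 'I_k -> 'I_b.+1}.

(** The difference of the two constraints is sum_i i f_i = n - l, where the
    part encoded by the index [i] is [i.+1]. *)
Lemma bell_index_leq f i : bell_index f -> (i * entry f i <= n - l)%N.
Proof.
move=> /andP[/eqP fn /eqP fl]; have [ik|ki] := ltnP i k; last first.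
  by rewrite entry_out ?muln0.
rewrite -fn -fl -sumnB => [|j _]; last by rewrite leq_pmull.
rewrite -[i]/(val (Ordinal ik)) entryE (bigD1 (Ordinal ik)) //=.
by rewrite mulSn addKn leq_addr.
Qed.

Lemma bell_index_supp0 f i : bell_index f -> (n - l < i)%N -> entry f i = 0%N.
Proof. by move=> /(bell_index_leq i); nia. Qed.

Lemma bell_index_entry_le f i : bell_index f -> (entry f i <= l)%N.
Proof.
move=> /andP[_ /eqP fl]; have [ik|ki] := ltnP i k; last by rewrite entry_out.
rewrite -fl -[i]/(val (Ordinal ik)) entryE (bigD1 (Ordinal ik)) //=.
exact: leq_addr.
Qed.

Lemma bell_indexE f : (n - l < k)%N ->
  (forall i, (n - l < i)%N -> entry f i = 0%N) ->
  bell_index f = ((\sum_(0 <= i < (n - l).+1) i.+1 * entry f i)%N == n) &&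
                 ((\sum_(0 <= i < (n - l).+1) entry f i)%N == l).
Proof.
move=> dk f0; rewrite /bell_index.
rewrite (@big_entry _ _ _ _ addn f (n - l).+1 (fun i m => i.+1 * m)%N) //.
  by rewrite (@big_entry _ _ _ _ addn f (n - l).+1 (fun i m => m)%N).
by move=> i; rewrite muln0.
Qed.

End Props.

Lemma bell_index_conv k b k' b' (f : {ffun 'I_k -> 'I_b.+1}) :
  (n - l < k)%N -> (n - l < k')%N -> (l <= b')%N -> bell_index f ->
  entry (of_entries k' b' (entry f)) =1 entry f /\
  bell_index (of_entries k' b' (entry f)).
Proof.
move=> dk dk' lb fP.
have E : entry (of_entries k' b' (entry f)) =1 entry f.
  move=> i; apply: of_entries_supp => j.
    exact/(leq_trans _ lb)/bell_index_entry_le.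
  by move=> k'j; rewrite (bell_index_supp0 fP) // (leq_trans dk').
split=> //; rewrite bell_indexE // => [|i di]; last first.
  by rewrite E (bell_index_supp0 fP).
have := fP; rewrite bell_indexE // => [|i di]; last first.
  by rewrite (bell_index_supp0 fP).
by under eq_bigr do rewrite -E; under [in X in _ && X -> _]eq_bigr do rewrite -E.
Qed.

(** The constraints force the entries beyond n - l to vanish and all entries to
    be at most l, so the sum does not depend on the box that the multiplicities
    are taken from.  This brings the partial Bell polynomials, whose boxes
    depend on l, to a common index set. *)
Lemma bell_index_reindex (R : comNzRingType) k b k' b' (G : nat -> nat -> R) :
  (n - l < k)%N -> (n - l < k')%N -> (l <= b)%N -> (l <= b')%N ->
  (forall i, G i 0%N = 1) ->
  \sum_(f : {ffun 'I_k -> 'I_b.+1} | bell_index f) \prod_(i < k) G i (f i) =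
  \sum_(f : {ffun 'I_k' -> 'I_b'.+1} | bell_index f) \prod_(i < k') G i (f i).
Proof.
move=> dk dk' lb lb' G0.
pose h (f : {ffun 'I_k' -> 'I_b'.+1}) := of_entries k b (entry f).
pose h' (f : {ffun 'I_k -> 'I_b.+1}) := of_entries k' b' (entry f).
have hK f : bell_index f -> h (h' f) = f.
  move=> fP; apply: entry_inj => i.
  have [E1 P1] := bell_index_conv dk dk' lb' fP.
  by rewrite (bell_index_conv dk' dk lb P1).1 E1.
have hK' f : bell_index f -> h' (h f) = f.
  move=> fP; apply: entry_inj => i.
  have [E1 P1] := bell_index_conv dk' dk lb fP.
  by rewrite (bell_index_conv dk dk' lb' P1).1 E1.
rewrite (reindex_onto h h') //; apply: eq_big => [f|f /andP[fP /eqP fE]].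
  apply/andP/idP => [[fP /eqP <-]|fP]; first exact: (bell_index_conv _ _ _ fP).2.
  by rewrite hK' // (bell_index_conv dk' dk lb fP).2.
have f'P : bell_index f by rewrite -fE; exact: (bell_index_conv _ _ _ fP).2.
rewrite !(@big_entry _ _ _ _ *%R _ (n - l).+1) //.
- by apply: eq_bigr => i _; rewrite (bell_index_conv _ _ _ f'P).1.
- by move=> i; apply: bell_index_supp0.
- by move=> i; apply: bell_index_supp0.
Qed.

End Multiplicities.

Lemma prod_expo (R : numFieldType) M (c : nat -> R) n :
  (\prod_(i < M) expo M i.+1 (c i))`_n =
  \sum_(f : {ffun 'I_M -> 'I_M.+1} | (\sum_(i < M) i.+1 * f i)%N == n)
     \prod_(i < M) (c i ^+ f i / (f i)`!%:R).
Proof.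
rewrite /expo bigA_distr_bigA /= coef_sum [RHS]big_mkcond.
apply: eq_bigr => f _.
transitivity ((\prod_(i < M) (c i ^+ f i / (f i)`!%:R)) *:
   'X^(\sum_(i < M) i.+1 * f i)%N : {poly R})`_n.
  congr (polyseq _)`_n.
  elim/big_rec3: _ => [|i p e q _ ->]; first by rewrite expr0 scale1r.
  by rewrite -scalerAl -scalerAr scalerA -exprD.
by rewrite coefZ coefXn eq_sym; case: eqP => _; rewrite ?mulr1 ?mulr0.
Qed.

Lemma partial_bellE (F : numFieldType) n l (x : nat -> F) :
  partial_bell n l x = n`!%:R *
    \sum_(f : {ffun 'I_(n - l).+1 -> 'I_l.+1} | bell_index n l f)
      \prod_(i < (n - l).+1) ((x i.+1 / (i.+1)`!%:R) ^+ f i / (f i)`!%:R).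
Proof.
rewrite mulr_sumr; apply: eq_bigr => f _.
by rewrite big_split /= prodfV mulrA mulrAC.
Qed.

(** Expanding the product of exponentials produces all multiplicity functions
    with sum_i (i+1) f_i = n; grouping them by l = sum_i f_i gives the partial
    Bell polynomials. *)
Lemma complete_bell_expo (F : numFieldType) n M (x : nat -> F) : (n < M)%N ->
  complete_bell n x / n`!%:R =
  (\prod_(i < M) expo M i.+1 (x i.+1 / (i.+1)`!%:R))`_n.
Proof.
move=> nM; rewrite (prod_expo M (fun i => x i.+1 / (i.+1)`!%:R)).
rewrite /complete_bell; under eq_bigr do rewrite partial_bellE.
rewrite -mulr_sumr mulrAC mulfV ?mul1r; last by rewrite pnatr_eq0 -lt0n fact_gt0.
rewrite big_mkord (partition_big (fun f : {ffun 'I_M -> 'I_M.+1} =>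
  inord (\sum_(i < M) f i) : 'I_n.+1) xpredT) //=.
apply: eq_bigr => l _; have ln : (l <= n)%N by rewrite -ltnS.
pose G i m := (x i.+1 / (i.+1)`!%:R) ^+ m / m`!%:R.
rewrite (@bell_index_reindex n l F _ _ M M G) //; last first.
- by move=> i; rewrite /G fact0 expr0 invr1 mulr1.
- lia.
- lia.
apply: eq_bigl => f; rewrite /bell_index; apply: andb_id2l => /eqP fn.
rewrite -val_eqE /= inordK // ltnS -fn.
by apply: leq_sum => i _; rewrite leq_pmull.
Qed.

(** * Interlacing partitions and the local rule *)

(** No monotonicity is imposed: interlacing with another array forces it. *)
Notation part_array N := {ffun 'I_N.+1 -> 'I_N.+1}.

Section Interlacing.
Variable N : nat.
Local Notation V := (part_array N).
Implicit Types kap lam mu nu : V.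

Definition weight lam : nat := (\sum_(i < N.+1) lam i)%N.

Definition interlace mu lam :=
  [forall i : 'I_N.+1, (entry mu i <= entry lam i)%N &&
                       (entry lam i.+1 <= entry mu i)%N].

Lemma interlaceP mu lam :
  reflect (forall i, (entry mu i <= entry lam i)%N /\
                     (entry lam i.+1 <= entry mu i)%N)
          (interlace mu lam).
Proof.
apply: (iffP forallP) => [H i|H i]; last exact/andP.
have [iN|Ni] := ltnP i N.+1; first exact: (andP (H (Ordinal iN))).
by rewrite !entry_out // ltnW.
Qed.

Lemma weightE lam d : (N < d)%N ->
  weight lam = (\sum_(0 <= i < d) entry lam i)%N.
Proof.
move=> Nd; rewrite (big_cat_nat _ Nd) //= [X in (_ + X)%N]big_nat_cond.
rewrite [X in (_ + X)%N]big1 ?addn0 => [|i /andP[/andP[Ni _] _]]; last first.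
  by rewrite entry_out.
by rewrite big_mkord; apply: eq_bigr => i _; rewrite entryE.
Qed.

Lemma leq_weight mu lam : interlace mu lam -> (weight mu <= weight lam)%N.
Proof.
move=> /interlaceP H; apply: leq_sum => i _.
by rewrite -!entryE; case: (H i).
Qed.

Lemma entry_leq_weight lam i : (entry lam i <= weight lam)%N.
Proof.
have [iN|Ni] := ltnP i N.+1; last by rewrite entry_out.
by rewrite -[i]/(val (Ordinal iN)) entryE /weight (bigD1 (Ordinal iN)) ?leq_addr.
Qed.

(** A nonzero last entry would make all [N.+1] entries nonzero. *)
Lemma entry_last0 lam : (forall i, entry lam i.+1 <= entry lam i)%N ->
  (weight lam <= N)%N -> entry lam N = 0%N.
Proof.
move=> lamS; apply: contraTeq; rewrite -lt0n -ltnNge => lamN.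
have lamD i d : (entry lam (i + d) <= entry lam i)%N.
  by elim: d => [|d IHd]; rewrite ?addn0 // addnS (leq_trans (lamS _)).
have lam_gt0 i : (i <= N)%N -> (0 < entry lam i)%N.
  by move=> iN; apply: leq_trans lamN _; have := lamD i (N - i)%N; rewrite subnKC.
rewrite -[X in (X <= _)%N](card_ord N.+1) -sum1_card; apply: leq_sum => i _.
by rewrite -entryE lam_gt0 // -ltnS.
Qed.

(** A relation rather than a function, so that both directions of the local
    rule share their consequences: the weight identity, the transfer of
    interlacing, and injectivity in [lam] and in [(m, kap)]. *)
Definition toggled mu nu m kap lam :=
  entry lam 0 = (maxn (entry mu 0) (entry nu 0) + m)%N /\
  forall i, (entry lam i.+1 + entry kap i)%N =
    (maxn (entry mu i.+1) (entry nu i.+1) + minn (entry mu i) (entry nu i))%N.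

(** Sum the defining equations over i <= N: by max(a, b) + min(a, b) = a + b the
    right-hand sides add up to |mu| + |nu| + m. *)
Lemma weight_toggled mu nu m kap lam : toggled mu nu m kap lam ->
  (weight lam + weight kap)%N = (weight mu + weight nu + m)%N.
Proof.
move=> [lam0 lamS].
pose M i := maxn (entry mu i) (entry nu i).
pose m' i := minn (entry mu i) (entry nu i).
have lamE : (weight lam + weight kap = M 0 + m + (\sum_(0 <= i < N.+1) M i.+1 +
    \sum_(0 <= i < N.+1) m' i))%N.
  rewrite (@weightE lam N.+2) // (weightE kap (leqnn _)) big_nat_recl // -addnA.
  by rewrite -!big_split /= lam0 (eq_bigr _ (fun i _ => lamS i)).
have ME : (M 0 + \sum_(0 <= i < N.+1) M i.+1 = \sum_(0 <= i < N.+1) M i)%N.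
  by rewrite -(big_nat_recl _ _ M) // big_nat_recr //= /M !entry_out ?addn0.
have munuE : (weight mu + weight nu = \sum_(0 <= i < N.+1) M i +
    \sum_(0 <= i < N.+1) m' i)%N.
  rewrite (weightE mu (leqnn _)) (weightE nu (leqnn _)) -!big_split /=.
  by apply: eq_bigr => i _; rewrite /M /m'; lia.
by rewrite lamE munuE -ME; lia.
Qed.

Definition toggle mu nu (p : 'I_N.+1 * V) : V :=
  of_entries N.+1 N (fun i =>
    if i is j.+1 then
      maxn (entry mu i) (entry nu i) + minn (entry mu j) (entry nu j) -
      entry p.2 j
    else maxn (entry mu 0) (entry nu 0) + p.1)%N.

Definition untoggle mu nu lam : 'I_N.+1 * V :=
  (inord (entry lam 0 - maxn (entry mu 0) (entry nu 0)),
   of_entries N.+1 N (fun i =>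
     maxn (entry mu i.+1) (entry nu i.+1) + minn (entry mu i) (entry nu i) -
     entry lam i.+1)%N).

(** The weight bound ensures that nothing is truncated: it keeps the first entry
    max(mu_0, nu_0) + m at most [N], and it makes mu_N vanish, without which the
    last entry kap_N would have to be balanced by an entry lam_(N+1). *)
Lemma toggled_toggle mu nu (p : 'I_N.+1 * V) :
  interlace p.2 mu -> interlace p.2 nu ->
  (p.1 + (weight nu - weight p.2) + weight mu <= N)%N ->
  toggled mu nu p.1 p.2 (toggle mu nu p).
Proof.
case: p => m kap /= km kn wN.
have kmE := interlaceP _ _ km; have knE := interlaceP _ _ kn.
have muS i : (entry mu i.+1 <= entry mu i)%N by have := kmE i; lia.
have muN : entry mu N = 0%N by apply: entry_last0 => //; lia.
have M0 : (maxn (entry mu 0) (entry nu 0) + m <= N)%N.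
  have le1 := entry_leq_weight mu 0.
  have le2 : (entry nu 0 - entry kap 0 <= weight nu - weight kap)%N.
    rewrite /weight -sumnB => [|i _]; last by rewrite -!entryE; case: (knE i).
    by rewrite (bigD1 ord0) //= -!entryE leq_addr.
  by have := kmE 0%N; lia.
have tE i : entry (toggle mu nu (m, kap)) i.+1 =
   (maxn (entry mu i.+1) (entry nu i.+1) + minn (entry mu i) (entry nu i) -
      entry kap i)%N.
  rewrite of_entries_supp //= => -[|j] //= => [|jN].
    by have := kmE j; have := knE j; have := entry_le mu j; lia.
  have := kmE j; have := kmE j.+1; have := knE j.
  have -> : entry mu j = 0%N.
    by have [->|Nj] : j = N \/ (N < j)%N; [lia | | rewrite entry_out].
  rewrite [entry nu j.+1]entry_out //; lia.
split=> [|i]; first by rewrite entry_of_entries.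
by rewrite tE; have := kmE i; have := knE i; lia.
Qed.

(** Nothing is truncated: since lam_(i+1) is at least max(mu_(i+1), nu_(i+1)), the
    value computed for kap_i is at most min(mu_i, nu_i). *)
Lemma toggled_untoggle mu nu lam :
  interlace mu lam -> interlace nu lam ->
  toggled mu nu (untoggle mu nu lam).1 (untoggle mu nu lam).2 lam.
Proof.
move=> /interlaceP ml /interlaceP nl; split=> [|i].
  rewrite /= inordK; have := ml 0%N; have := nl 0%N; have := entry_le lam 0;
    lia.
rewrite of_entries_supp => [|j|j Nj].
- by have := ml i.+1; have := nl i.+1; have := ml i; have := nl i; lia.
- by have := ml j.+1; have := nl j.+1; have := entry_le mu j; lia.
- have Nj1 := ltnW Nj.
  by rewrite ?[entry _ _]entry_out.
Qed.

Lemma toggled_fun mu nu m kap lam lam' :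
  toggled mu nu m kap lam -> toggled mu nu m kap lam' -> lam = lam'.
Proof.
move=> [l0 lS] [l0' lS']; apply: entry_inj => -[|i]; first by rewrite l0.
by have := lS i; have := lS' i; lia.
Qed.

Lemma toggled_inj mu nu lam (p p' : 'I_N.+1 * V) :
  toggled mu nu p.1 p.2 lam -> toggled mu nu p'.1 p'.2 lam -> p = p'.
Proof.
case: p p' => [m kap] [m' kap'] /= [l0 lS] [l0' lS']; congr pair.
  by apply: val_inj => /=; lia.
by apply: entry_inj => i; have := lS i; have := lS' i; lia.
Qed.

(** For each i, lam_(i+1) and kap_i are reflections of each other in the interval
    from max(mu_(i+1), nu_(i+1)) to min(mu_i, nu_i), and interlacing with mu and
    nu means exactly that they lie in it; lam_0 >= max(mu_0, nu_0) holds by the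
    first equation. *)
Lemma toggled_interlace mu nu m kap lam : toggled mu nu m kap lam ->
  interlace mu lam && interlace nu lam = interlace kap mu && interlace kap nu.
Proof.
move=> [l0 lS]; apply/andP/andP => -[/interlaceP H1 /interlaceP H2].
  split; apply/interlaceP => i; have := lS i; have := H1 i; have := H2 i;
    have := H1 i.+1; have := H2 i.+1; lia.
split; apply/interlaceP => -[|i]; have := lS 0%N; have := H1 0%N;
  have := H2 0%N; try lia;
  have := lS i; have := lS i.+1; have := H1 i; have := H2 i;
  have := H1 i.+1; have := H2 i.+1; lia.
Qed.

End Interlacing.

(** * Cauchy summation of chains of partitions *)

Section Cauchy.
Variables (R : comNzRingType) (N : nat).
Local Notation V := (part_array N).
Implicit Types kap lam mu nu : V.
Local Notation G := (geo R N).

(** The number m of the local rule becomes the index of the geometric series.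
    Since |lam| = |mu| + (|nu| - |kap|) + m, the exponent on the left is
    (i+1) m + (i+1) (|nu| - |kap|) + |mu|, as on the right. *)
Lemma sum_toggle mu nu i :
  \sum_(lam : V | interlace mu lam && interlace nu lam)
     'X^(i * (weight lam - weight mu) + weight lam)
  =X G i.+1 * \sum_(kap : V | interlace kap mu && interlace kap nu)
       'X^(i.+1 * (weight nu - weight kap) + weight mu) %[N].
Proof.
apply: eqmodX_trans; first exact: eqmodX_trunc.
have -> : G i.+1 * \sum_(kap : V | interlace kap mu && interlace kap nu)
      'X^(i.+1 * (weight nu - weight kap) + weight mu) =
    \sum_(p : 'I_N.+1 * V | interlace p.2 mu && interlace p.2 nu)
      'X^(i.+1 * p.1 + (i.+1 * (weight nu - weight p.2) + weight mu)).
  rewrite big_distrlr /= pair_big /=.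
  by apply: eq_bigr => p _; rewrite -exprD.
apply: eqmodX_sym; apply: eqmodX_trans; first exact: eqmodX_trunc.
move=> k _; congr (polyseq _)`_k; symmetry.
(* [e] and [e'] are the exponents on the two sides. *)
pose e lam := (i * (weight lam - weight mu) + weight lam)%N.
pose e' (p : 'I_N.+1 * V) :=
  (i.+1 * p.1 + (i.+1 * (weight nu - weight p.2) + weight mu))%N.
have ee' lam (p : 'I_N.+1 * V) : interlace mu lam -> interlace p.2 nu ->
    toggled mu nu p.1 p.2 lam -> e lam = e' p.
  move=> /leq_weight lm /leq_weight kn /weight_toggled lkE; rewrite /e /e'.
  by have -> : weight lam = (weight mu + ((weight nu - weight p.2) + p.1))%N; lia.
have tog p : interlace p.2 mu && interlace p.2 nu && (e' p <= N)%N ->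
    toggled mu nu p.1 p.2 (toggle mu nu p).
  move=> /andP[/andP[km kn] eN]; apply: toggled_toggle => //.
  by move: eN; rewrite /e'; nia.
have untog lam : interlace mu lam && interlace nu lam ->
    toggled mu nu (untoggle mu nu lam).1 (untoggle mu nu lam).2 lam.
  by move=> /andP[ml nl]; apply: toggled_untoggle.
have goodl lam (p : 'I_N.+1 * V) : toggled mu nu p.1 p.2 lam ->
    (interlace mu lam && interlace nu lam && (e lam <= N)%N) =
    (interlace p.2 mu && interlace p.2 nu && (e' p <= N)%N).
  move=> t; rewrite -(toggled_interlace t); apply: andb_id2l => int.
  have := int; rewrite (toggled_interlace t) => /andP[_ kn].
  by case/andP: int => ml _; rewrite (ee' _ _ ml kn t).
rewrite (reindex_onto (toggle mu nu) (untoggle mu nu)) => [|lam]; last first.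
  move=> /[dup] /andP[/untog t _]; rewrite (goodl _ _ t) => /tog t'.
  exact: toggled_fun t' t.
apply: eq_big => [p|p]; last first.
  move=> /andP[/[dup] /andP[/andP[ml nl] _] + /eqP].
  move: (untog (toggle mu nu p)); rewrite ml nl => /(_ isT) + _ pE.
  rewrite pE => t; have := toggled_interlace t; rewrite ml nl.
  by move=> /esym/andP[_ kn]; congr 'X^_; apply: ee'.
apply/andP/idP => [[lP /eqP pE]|pP].
  have /untog t : interlace mu (toggle mu nu p) && interlace nu (toggle mu nu p).
    by case/andP: lP.
  by move: lP; rewrite (goodl _ _ t) pE.
have t := tog _ pP; rewrite (goodl _ _ t) pP; split=> //.
apply/eqP; apply: (toggled_inj _ t); apply: untog.
by rewrite (toggled_interlace t); case/andP: pP.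
Qed.

Definition vempty : V := [ffun=> ord0].

(** The chains descending from [lam] to the empty array in [c] steps are weighted
    without [lam] itself, because the main diagonal is shared by two chains.
    Multiplied by X^|lam|, this is the Schur function s_lam(X, X^2, ..., X^c). *)
Fixpoint chain_gf c lam : {poly R} :=
  if c is c'.+1 then
    \sum_(rho | interlace rho lam) 'X^(weight rho) * chain_gf c' rho
  else (lam == vempty)%:R.

Lemma entry_vempty i : entry vempty i = 0%N.
Proof.
have [iN|Ni] := ltnP i N.+1; last by rewrite entry_out.
by rewrite -[i]/(val (Ordinal iN)) entryE ffunE.
Qed.

Lemma weight_vempty : weight vempty = 0%N.
Proof. by apply: big1 => i _; rewrite ffunE. Qed.

Lemma interlace_vempty mu : interlace mu vempty = (mu == vempty).
Proof.
apply/interlaceP/eqP => [H|-> i]; last by rewrite !entry_vempty.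
apply: entry_inj => j.
have [] := H j; rewrite !entry_vempty; lia.
Qed.

Lemma chain_gf_vempty c : chain_gf c vempty = 1.
Proof.
elim: c => [|c IHc] /=; first by rewrite eqxx.
under eq_bigl do rewrite interlace_vempty.
by rewrite big_pred1_eq weight_vempty IHc mulr1.
Qed.

(** By induction along the chain: the local rule exchanges the first step from
    [lam] down to [nu] for a step from [mu] down to some [kap], costs one
    geometric series, and raises the exponent [i] by one. *)
Lemma sum_chain_gf c i mu :
  \sum_(lam | interlace mu lam)
     'X^(i * (weight lam - weight mu)) * ('X^(weight lam) * chain_gf c lam)
  =X \prod_(j < c) G (i + j).+1 * ('X^(weight mu) * chain_gf c mu) %[N].
Proof.
elim: c i mu => [|c IHc] i mu.
  rewrite big_ord0 mul1r /= big_mkcond (bigD1 vempty) //=.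
  rewrite big1 => [|lam /negPf lam0].
    rewrite interlace_vempty eqxx weight_vempty; case: eqP => [->|_].
      by rewrite weight_vempty muln0 expr0 !mul1r addr0.
    by rewrite addr0 mulr0.
  by rewrite lam0 !mulr0 if_same.
have -> : \sum_(lam | interlace mu lam)
   'X^(i * (weight lam - weight mu)) * ('X^(weight lam) * chain_gf c.+1 lam) =
   \sum_nu (\sum_(lam : V | interlace mu lam && interlace nu lam)
     'X^(i * (weight lam - weight mu) + weight lam)) *
       ('X^(weight nu) * chain_gf c nu).
  under eq_bigr do rewrite /= mulrA -exprD mulr_sumr.
  rewrite (exchange_big_dep predT) //=; apply: eq_bigr => nu _.
  by rewrite mulr_suml.
apply: eqmodX_trans.
  by apply: eqmodX_sum => nu _; apply/eqmodXMr/sum_toggle.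
rewrite big_ord_recl addn0.
have -> : \prod_(j < c) G (i + lift ord0 j).+1 = \prod_(j < c) G (i.+1 + j).+1.
  by apply: eq_bigr => j _; rewrite /= /bump add1n addSnnS.
have -> : \sum_(nu : V)
    G i.+1 * (\sum_(kap : V | interlace kap mu && interlace kap nu)
      'X^(i.+1 * (weight nu - weight kap) + weight mu)) *
      ('X^(weight nu) * chain_gf c nu) =
   G i.+1 * ('X^(weight mu) * \sum_(kap | interlace kap mu)
      \sum_(nu | interlace kap nu)
        'X^(i.+1 * (weight nu - weight kap)) * ('X^(weight nu) * chain_gf c nu)).
  rewrite (exchange_big_dep predT) //= 2!mulr_sumr; apply: eq_bigr => nu _.
  rewrite -mulrA; congr (_ * _); rewrite mulr_suml [RHS]mulr_sumr.
  apply: eq_bigr => kap _; rewrite exprD; ring.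
rewrite -mulrA; apply: eqmodXMl.
rewrite mulrCA; apply: eqmodXMl => /=; rewrite mulr_sumr.
by apply: eqmodX_sum => kap _; apply: IHc.
Qed.

(** Each step removes the first member [rho] of the second chain, by summing over
    all [lam] above it with [sum_chain_gf]. *)
Lemma cauchy c r i :
  \sum_lam 'X^(i * weight lam) * chain_gf r lam *
    ('X^(weight lam) * chain_gf c lam)
  =X \prod_(k < r) \prod_(j < c) G (i + k + j).+1 %[N].
Proof.
elim: r i => [|r IHr] i.
  rewrite big_ord0 (bigD1 vempty) //= big1 => [|lam /negPf ->].
    by rewrite eqxx weight_vempty muln0 expr0 chain_gf_vempty !mul1r addr0.
  by rewrite mulr0 mul0r.
have -> : \sum_lam 'X^(i * weight lam) * chain_gf r.+1 lam *
    ('X^(weight lam) * chain_gf c lam) =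
  \sum_rho 'X^(i.+1 * weight rho) * chain_gf r rho *
    \sum_(lam | interlace rho lam)
     'X^(i * (weight lam - weight rho)) * ('X^(weight lam) * chain_gf c lam).
  under eq_bigr do rewrite /= mulr_sumr mulr_suml.
  rewrite (exchange_big_dep predT) //=; apply: eq_bigr => rho _.
  rewrite mulr_sumr; apply: eq_bigr => lam /leq_weight lrho.
  have -> : (i * weight lam = i * weight rho + i * (weight lam - weight rho))%N.
    by rewrite -mulnDr subnKC.
  by rewrite mulSn !exprD; ring.
apply: eqmodX_trans.
  by apply: eqmodX_sum => rho _; apply/eqmodXMl/sum_chain_gf.
rewrite big_ord_recl addn0.
have -> : \prod_(k < r) \prod_(j < c) G (i + lift ord0 k + j).+1 =
    \prod_(k < r) \prod_(j < c) G (i.+1 + k + j).+1.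
  apply: eq_bigr => k _; apply: eq_bigr => j _.
  by rewrite /= /bump add1n addSnnS.
under eq_bigr do rewrite mulrCA.
rewrite -mulr_sumr; apply: eqmodXMl; exact: IHr.
Qed.
End Cauchy.

(** * Counting plane partitions by their diagonals *)

Lemma fsbig_natE (T : choiceType) (f : T -> nat) (r : seq T) : uniq r ->
  (forall x, x \notin r -> f x = 0%N) ->
  \sum_(x \in [set: T]%classic) f x = (\sum_(x <- r) f x)%N.
Proof.
move=> ur fr; rewrite (@fsbigE _ _ _ _ _ r) //; last by move=> x _; apply: fr.
by apply: eq_bigl => x; rewrite in_setT.
Qed.

(** Finiteness of the support matters: the right-hand side would otherwise be 0
    by convention. *)
Lemma leq_fsbig_nat (T : choiceType) (f : T -> nat) (r : seq T) : uniq r ->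
  finite_set [set x | f x <> 0%N]%classic ->
  (\sum_(x <- r) f x <= \sum_(x \in [set: T]%classic) f x)%N.
Proof.
move=> ur /finite_fsetP[X fX].
rewrite (@fsbig_natE _ _ (r ++ [seq x <- enum_fset X | x \notin r])).
- by rewrite big_cat leq_addr.
- rewrite cat_uniq ur filter_uniq ?fset_uniq // andbT -all_predC.
  by apply/allP => x; rewrite mem_filter => /andP[].
- move=> x; rewrite mem_cat mem_filter negb_or => /andP[xr].
  rewrite xr /=; apply: contraNeq => /eqP fx.
  by have : [set` X]%classic x by rewrite -fX.
Qed.

Lemma card_fset_set_image (T : finType) (U : choiceType) (A : {set T})
    (f : T -> U) : injective f ->
  #|` fset_set [set f x | x in [set` A]]%classic|%fset = #|A|.
Proof.
move=> fI; have -> : [set f x | x in [set` A]]%classic =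
    [set` [fset f x | x in A]%fset]%classic.
  apply/predeqP => u; split=> [[x xA <-]|/= /imfsetP[x xA ->]].
    by apply/imfsetP; exists x.
  by exists x.
by rewrite set_fsetK card_imfset //= cardE.
Qed.

Section Diagonals.
Variable N : nat.
Local Notation V := (part_array N).
Local Notation v0 := (vempty N).

Definition is_chain c (lam : V) (s : c.-tuple V) :=
  path (fun a b => interlace b a) lam s && (last lam s == v0).

Lemma chain_gfE (R : comNzRingType) c lam : chain_gf R c lam =
  \sum_(s : c.-tuple V | is_chain lam s) 'X^(\sum_(rho <- s) weight rho).
Proof.
elim: c lam => [|c IHc] lam /=.
  rewrite big_mkcond (big_pred1 [tuple]) => [|s]; last first.
    exact/esym/eqP/tuple0.
  by rewrite /is_chain /= big_nil expr0; case: eqP.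
under eq_bigr do rewrite IHc mulr_sumr.
rewrite pair_big_dep /=.
pose h (p : V * c.-tuple V) := [tuple of p.1 :: p.2].
rewrite [RHS](reindex h) /=; last first.
  exists (fun s => (thead s, [tuple of behead s])) => [[rho s] _|s _].
    by congr pair; apply: val_inj.
  by rewrite /h /= [RHS]tuple_eta; apply: val_inj.
apply: eq_big => [[rho s]|[rho s] _] /=; first by rewrite /is_chain /= andbA.
by rewrite big_cons exprD.
Qed.

(** The main diagonal, followed by the diagonals above it and those below it. *)
Definition diagonals := (V * N.-tuple V * N.-tuple V)%type.

Definition plane_of (p : diagonals) (i j : nat) : nat :=
  if (i <= j)%N then entry (nth v0 (p.1.1 :: p.1.2) (j - i)) i
  else entry (nth v0 (p.1.1 :: p.2) (i - j)) j.

Definition diagonals_ok (p : diagonals) :=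
  is_chain p.1.1 p.1.2 && is_chain p.1.1 p.2.

Definition diagonals_weight (p : diagonals) : nat :=
  (weight p.1.1 + \sum_(rho <- p.1.2) weight rho +
   \sum_(rho <- p.2) weight rho)%N.

Lemma coef_sum_diagonals (R : comNzRingType) n :
  (\sum_(lam : V) chain_gf R N lam * ('X^(weight lam) * chain_gf R N lam))`_n =
  #|[set p : diagonals | diagonals_ok p & diagonals_weight p == n]|%:R.
Proof.
have -> : \sum_(lam : V) chain_gf R N lam * ('X^(weight lam) * chain_gf R N lam) =
    \sum_(p : diagonals | diagonals_ok p) 'X^(diagonals_weight p).
  transitivity (\sum_(q : V * N.-tuple V | is_chain q.1 q.2)
      \sum_(s : N.-tuple V | is_chain q.1 s)
        'X^(diagonals_weight (q, s)) : {poly R}); last first.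
    by rewrite pair_big_dep /=; apply: eq_big => -[].
  rewrite -(pair_big_dep xpredT (fun lam s => is_chain lam s) (fun lam s =>
     \sum_(s' : N.-tuple V | is_chain lam s')
       'X^(diagonals_weight ((lam, s), s')))) /=.
  apply: eq_bigr => lam _; rewrite mulrCA chain_gfE mulr_suml mulr_sumr.
  apply: eq_bigr => s _; rewrite !mulr_sumr; apply: eq_bigr => s' _.
  by rewrite -!exprD /diagonals_weight /= addnA.
rewrite -sum1_card natr_sum coef_sum [RHS]big_mkcond [LHS]big_mkcond /=.
apply: eq_bigr => p _; rewrite inE coefXn eq_sym.
by case: diagonals_ok => //=; case: eqP.
Qed.

Lemma plane_of_upper p i d :
  plane_of p i (i + d) = entry (nth v0 (p.1.1 :: p.1.2) d) i.
Proof. by rewrite /plane_of leq_addr addKn. Qed.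

Lemma plane_of_lower p i d :
  plane_of p (i + d) i = entry (nth v0 (p.1.1 :: p.2) d) i.
Proof.
case: d => [|d]; first by rewrite addn0 /plane_of leqnn subnn.
by rewrite /plane_of leqNgt -ltn_subLR // subnn addKn.
Qed.

Lemma plane_of_diag p i : plane_of p i i = entry p.1.1 i.
Proof. by rewrite -[X in plane_of p i X]addn0 plane_of_upper. Qed.

Lemma plane_of_inj : injective plane_of.
Proof.
move=> [[lam s] s'] [[mu t] t'] pq.
have pqE i j : plane_of (lam, s, s') i j = plane_of (mu, t, t') i j by rewrite pq.
congr (_, _, _).
- by apply: entry_inj => i; have := pqE i i; rewrite !plane_of_diag.
- apply: val_inj; apply: (@eq_from_nth _ v0) => [|d _]; rewrite ?size_tuple //.
  by apply: entry_inj => i; have := pqE i (i + d.+1)%N; rewrite !plane_of_upper.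
- apply: val_inj; apply: (@eq_from_nth _ v0) => [|d _]; rewrite ?size_tuple //.
  by apply: entry_inj => i; have := pqE (i + d.+1)%N i; rewrite !plane_of_lower.
Qed.

(** Beyond its end a chain continues with empty arrays, so that the interlacing
    holds at every position. *)
Lemma is_chainP c lam (s : c.-tuple V) :
  reflect ((forall k, interlace (nth v0 (lam :: s) k.+1) (nth v0 (lam :: s) k)) /\
           nth v0 (lam :: s) c = v0)
          (is_chain lam s).
Proof.
have lastE : nth v0 (lam :: s) c = last lam s.
  by rewrite (last_nth v0) size_tuple.
apply: (iffP andP) => [[/(pathP v0) H /eqP s0]|[H s0]]; last first.
  split; last by rewrite -lastE s0.
  by apply/(pathP v0) => k ks; apply: H.
split=> [k|]; last by rewrite lastE.
have [kc|ck] := ltnP k c; first by apply: (H k); rewrite size_tuple.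
rewrite [nth _ _ k.+1]nth_default /= ?size_tuple ?ltnS //.
have -> : nth v0 (lam :: s) k = v0.
  move: ck; rewrite leq_eqVlt => /predU1P[<-|ck]; first by rewrite lastE.
  by rewrite nth_default //= size_tuple.
by rewrite interlace_vempty.
Qed.

(** Moving one step right or down in the array moves to a neighbouring diagonal,
    at the same or the next position: both monotonicity conditions together are
    the interlacing of neighbouring diagonals. *)
Lemma plane_of_mono p : diagonals_ok p -> forall i j,
  (plane_of p i j.+1 <= plane_of p i j)%N /\
  (plane_of p i.+1 j <= plane_of p i j)%N.
Proof.
move=> /andP[/is_chainP[up _] /is_chainP[lo _]] i j.
have upE d := interlaceP _ _ (up d); have loE d := interlaceP _ _ (lo d).
have [ij|ji] := leqP i j.
  rewrite -(subnKC ij); move: (j - i)%N => d {ij}.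
  rewrite -addnS !plane_of_upper; split; first by case: (upE d i).
  case: d => [|d].
    by rewrite addn0 -addn1 plane_of_lower; case: (loE 0%N i).
  by rewrite addnS -addSn plane_of_upper; case: (upE d i).
have -> : i = (j + (i - j.+1).+1)%N by lia.
move: (i - j.+1)%N => d {ji}; rewrite -addnS !plane_of_lower.
split; last by case: (loE d.+1 j).
by rewrite addnS -addSn plane_of_lower; case: (loE d j).
Qed.

(** The cells that [plane_of] can fill, listed diagonal by diagonal, so that
    summing over this list gives the weights of the diagonals. *)
Definition diagonal_cells : seq (nat * nat) :=
  [seq (i, i) | i <- iota 0 N.+1] ++
  [seq (i, i + d.+1)%N | d <- iota 0 N, i <- iota 0 N.+1] ++
  [seq (i + d.+1, i)%N | d <- iota 0 N, i <- iota 0 N.+1].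

Lemma diagonal_cells_uniq : uniq diagonal_cells.
Proof.
rewrite !cat_uniq map_inj_uniq ?iota_uniq => [|i j [] //].
rewrite !allpairs_uniq ?iota_uniq //; first last.
- by move=> [d i] [d' i'] _ _ [] /= *; congr pair; lia.
- by move=> [d i] [d' i'] _ _ [] /= *; congr pair; lia.
rewrite !andTb andbT; apply/andP; split; apply/hasPn => x.
  rewrite mem_cat => /orP[] /allpairsPdep[d [i [_ _ ->]]];
    by apply/negP => /mapP[j _ []]; lia.
move=> /allpairsPdep[d [i [_ _ ->]]].
by apply/negP => /allpairsPdep[d' [i' [_ _ []]]]; lia.
Qed.

Lemma plane_of_supp p x : x \notin diagonal_cells -> plane_of p x.1 x.2 = 0%N.
Proof.
case: x => i j; rewrite mem_cat negb_or mem_cat negb_or => /and3P[H0 H1 H2].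
have [ij|ji|ij] := ltngtP i j.
- have jE : j = (i + (j - i.+1).+1)%N by lia.
  rewrite jE plane_of_upper.
  have [iN|Ni] := ltnP i N.+1; last by rewrite entry_out.
  have [dN|Nd] := ltnP (j - i.+1) N; last first.
    by rewrite nth_default ?entry_vempty ?size_tuple.
  case/negP: H1; apply/allpairsPdep; exists (j - i.+1)%N, i.
  by rewrite !mem_iota /= -jE.
- have iE : i = (j + (i - j.+1).+1)%N by lia.
  rewrite iE plane_of_lower.
  have [jN|Nj] := ltnP j N.+1; last by rewrite entry_out.
  have [dN|Nd] := ltnP (i - j.+1) N; last first.
    by rewrite nth_default ?entry_vempty ?size_tuple.
  case/negP: H2; apply/allpairsPdep; exists (i - j.+1)%N, j.
  by rewrite !mem_iota /= -iE.
- rewrite -ij plane_of_diag.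
  have [iN|Ni] := ltnP i N.+1; last by rewrite entry_out.
  by case/negP: H0; apply/mapP; exists i; rewrite ?mem_iota -?ij.
Qed.

Lemma sum_plane_of p :
  \sum_(x \in [set: nat * nat]%classic) plane_of p x.1 x.2 = diagonals_weight p.
Proof.
rewrite (fsbig_natE diagonal_cells_uniq); last exact: plane_of_supp.
rewrite !big_cat big_map !big_allpairs_dep /diagonals_weight -addnA.
have wE (rho : V) : (\sum_(i <- iota 0 N.+1) entry rho i)%N = weight rho.
  by rewrite (weightE rho (leqnn _)) /index_iota subn0.
have sE (s : N.-tuple V) : (\sum_(rho <- s) weight rho =
    \sum_(d <- iota 0 N) \sum_(i <- iota 0 N.+1) entry (nth v0 s d) i)%N.
  rewrite (big_nth v0) size_tuple /index_iota subn0.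
  by apply: eq_bigr => d _; rewrite wE.
rewrite !sE -wE; congr (_ + (_ + _))%N.
- by apply: eq_bigr => i _; rewrite plane_of_diag.
- by apply: eq_bigr => d _; apply: eq_bigr => i _; rewrite plane_of_upper.
- by apply: eq_bigr => d _; apply: eq_bigr => i _; rewrite plane_of_lower.
Qed.

Lemma plane_of_partition p :
  diagonals_ok p -> plane_partition (diagonals_weight p) (plane_of p).
Proof.
move=> /plane_of_mono pM; split=> [i j|i j||]; try by case: (pM i j).
  apply: (sub_finite_set _ (finite_seq diagonal_cells)) => x /= xp.
  by apply: contra_notT xp => /plane_of_supp.
exact: sum_plane_of.
Qed.

(** [upper_diagonals] will be applied to a plane partition and to its
    transpose. *)
Section Box.
Variable b : nat -> nat -> nat.
Hypothesis bS : forall i j, (b i j.+1 <= b i j)%N /\ (b i.+1 j <= b i j)%N.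
Hypothesis b_le : forall i j, (b i j <= N)%N.
Hypothesis b_row : forall i j, (N <= i)%N -> b i j = 0%N.
Hypothesis b_col : forall i j, (N <= j)%N -> b i j = 0%N.

Definition diagonal d : V := of_entries N.+1 N (fun i => b i (i + d)%N).
Definition upper_diagonals : N.-tuple V := [tuple diagonal d.+1 | d < N].

Lemma entry_diagonal d i : entry (diagonal d) i = b i (i + d)%N.
Proof. by apply: of_entries_supp => // j Nj; rewrite b_row // ltnW. Qed.

Lemma nth_diagonals d :
  nth v0 (diagonal 0 :: upper_diagonals) d = diagonal d.
Proof.
case: d => // d; change (nth v0 upper_diagonals d = diagonal d.+1).
have [dN|Nd] := ltnP d N.
  by rewrite -[d in LHS]/(val (Ordinal dN)) -tnth_nth tnth_mktuple.
rewrite nth_default ?size_tuple //; apply: entry_inj => i.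
by rewrite entry_vempty entry_diagonal b_col //; lia.
Qed.

Lemma diagonals_chain : is_chain (diagonal 0) upper_diagonals.
Proof.
apply/is_chainP; split=> [k|].
  rewrite !nth_diagonals; apply/interlaceP => i; rewrite !entry_diagonal addnS.
  by rewrite addSn; split; [case: (bS i (i + k)) | case: (bS i (i + k).+1)].
rewrite nth_diagonals; apply: entry_inj => i.
by rewrite entry_vempty entry_diagonal b_col // leq_addl.
Qed.
End Box.

(** If a_(i,j) > 0 then it and the i entries above it in its column are positive,
    so i + 1 <= n; likewise for its row. *)
Lemma plane_partition_bounds n a : plane_partition n a ->
  (forall i j, a i j <= n)%N /\
  (forall i j, (n <= i)%N -> a i j = 0%N) /\
  (forall i j, (n <= j)%N -> a i j = 0%N).
Proof.
move=> [aj ai fin an].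
have le_sum r : uniq r -> (\sum_(x <- r) a x.1 x.2 <= n)%N.
  by move=> ur; rewrite -an; apply: leq_fsbig_nat.
have ajD i j d : (a i (j + d) <= a i j)%N.
  by elim: d => [|d IHd]; rewrite ?addn0 // addnS (leq_trans (aj _ _)).
have aiD i j d : (a (i + d) j <= a i j)%N.
  by elim: d => [|d IHd]; rewrite ?addn0 // addnS (leq_trans (ai _ _)).
have ajE i j j' : (j' <= j)%N -> (a i j <= a i j')%N.
  by move=> jj; rewrite -(subnKC jj).
have aiE i i' j : (i' <= i)%N -> (a i j <= a i' j)%N.
  by move=> ii; rewrite -(subnKC ii).
split=> [i j|].
  by have := le_sum [:: (i, j)] isT; rewrite big_seq1.
split=> i j nij; apply/eqP; rewrite -leqn0 leqNgt; apply/negP => aij.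
  have := le_sum [seq (i', j) | i' <- iota 0 i.+1].
  rewrite map_inj_uniq ?iota_uniq => [/(_ isT)|i1 i2 [] //].
  rewrite big_map leqNgt => /negP; apply.
  apply: leq_trans (_ : \sum_(i' <- iota 0 i.+1) 1 <= _)%N.
    by rewrite sum1_size size_iota ltnS.
  rewrite big_seq [X in (_ <= X)%N]big_seq; apply: leq_sum => i'.
  by rewrite mem_iota /= add0n ltnS => ii; exact: leq_trans aij (aiE _ _ _ ii).
have := le_sum [seq (i, j') | j' <- iota 0 j.+1].
rewrite map_inj_uniq ?iota_uniq => [/(_ isT)|i1 i2 [] //].
rewrite big_map leqNgt => /negP; apply.
apply: leq_trans (_ : \sum_(j' <- iota 0 j.+1) 1 <= _)%N.
  by rewrite sum1_size size_iota ltnS.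
rewrite big_seq [X in (_ <= X)%N]big_seq; apply: leq_sum => j'.
by rewrite mem_iota /= add0n ltnS => jj; exact: leq_trans aij (ajE _ _ _ jj).
Qed.

(** Reading off the diagonals inverts [plane_of]; a plane partition of [n] fits,
    because its nonzero entries lie in an n x n square. *)
Lemma PL_card n : (n <= N)%N ->
  PL n = #|[set p : diagonals | diagonals_ok p & diagonals_weight p == n]|.
Proof.
move=> nN; rewrite -(card_fset_set_image _ plane_of_inj) /PL.
congr #|` fset_set _ |%fset; apply/predeqP => a; split=> [aP|[p]]; last first.
  by rewrite /= inE => /andP[pP /eqP <-] <-; apply: plane_of_partition.
have [a_le [a_row a_col]] := plane_partition_bounds aP.
have [aj ai fin an] := aP.
pose at' i j := a j i.
pose p : diagonals := (diagonal a 0, upper_diagonals a, upper_diagonals at').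
have a_leN i j : (a i j <= N)%N by exact: leq_trans nN.
have a_rowN i j : (N <= i)%N -> a i j = 0%N.
  by move=> Ni; apply/a_row/(leq_trans nN).
have a_colN i j : (N <= j)%N -> a i j = 0%N.
  by move=> Nj; apply/a_col/(leq_trans nN).
have a_leN' i j : (at' i j <= N)%N by exact: a_leN.
have a_rowN' i j : (N <= i)%N -> at' i j = 0%N by exact: a_colN.
have a_colN' i j : (N <= j)%N -> at' i j = 0%N by exact: a_rowN.
have d0 : diagonal a 0 = diagonal at' 0.
  by apply: entry_inj => i; rewrite !entry_diagonal // /at' addn0.
have pa : plane_of p = a.
  apply/funext => i; apply/funext => j; have [ij|/ltnW ji] := leqP i j.
    by rewrite -(subnKC ij) plane_of_upper nth_diagonals // entry_diagonal.
  rewrite -(subnKC ji) plane_of_lower /= d0 (nth_diagonals (b := at')) //.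
  by rewrite entry_diagonal.
exists p => //=; rewrite inE -sum_plane_of pa an eqxx andbT /diagonals_ok /=.
apply/andP; split; first exact: diagonals_chain.
by rewrite d0; apply: (diagonals_chain (b := at')) => // i j; split; rewrite /at'.
Qed.

(** MacMahon's formula.  Bounding the indices of the product by [N] loses only
    factors that are 1 up to degree [N]. *)
Lemma PL_coef (R : comNzRingType) n : (n <= N)%N ->
  (PL n)%:R = (\prod_(k < N) \prod_(j < N) geo R N (k + j).+1)`_n.
Proof.
move=> nN; rewrite (PL_card nN) -coef_sum_diagonals.
rewrite -(cauchy R (N:=N) N N 0 nN); congr (polyseq _)`_n.
by apply: eq_bigr => lam _; rewrite mul0n mul1r.
Qed.

End Diagonals.

(** * Comparison of logarithmic derivatives *)

(** The value h occurs as i + j + 1 for exactly h pairs (i, j). *)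
Lemma sum_antidiagonals N (g : nat -> nat) :
  (forall h, (N < h)%N -> g h = 0%N) ->
  (\sum_(i < N) \sum_(j < N) g (i + j).+1 = \sum_(h < N) h.+1 * g h.+1)%N.
Proof.
move=> g0; transitivity (\sum_(i < N) \sum_(h < N | i <= h) g h.+1)%N.
  apply: eq_bigr => i _; have iN := ltnW (ltn_ord i).
  rewrite -(big_mkord xpredT (fun j => g (i + j).+1)).
  rewrite -(big_mkord (fun h => (i <= h)%N) (fun h => g h.+1)).
  transitivity (\sum_(i <= h < N) g h.+1)%N; last by rewrite (big_nat_widenl i 0).
  rewrite -{2}[i : nat]add0n big_addn (big_cat_nat _ (leq_subr i N)) //=.
  rewrite [X in (_ + X)%N]big_nat_cond [X in (_ + X)%N]big1 => [|h]; last first.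
    by move=> /andP[/andP[hi _] _]; apply: g0; lia.
  by rewrite addn0; apply: eq_bigr => h _; rewrite addnC.
rewrite (exchange_big_dep xpredT) //=; apply: eq_bigr => h _.
rewrite -(big_mkord (fun i => (i <= h)%N) (fun=> g h.+1)).
by rewrite -(big_nat_widen 0 h.+1 N xpredT) // sum_nat_const_nat subn0.
Qed.

Lemma sigma_sum k m N : (0 < m)%N -> (m <= N)%N ->
  sigma k m = (\sum_(h < N) (h.+1 %| m) * h.+1 ^ k)%N.
Proof.
move=> m0 mN; rewrite /sigma.
rewrite (perm_big [seq d <- iota 1 N | (d %| m)%N]) /=; last first.
  apply: uniq_perm; rewrite ?filter_uniq ?divisors_uniq ?iota_uniq // => d.
  rewrite -dvdn_divisors // mem_filter mem_iota.
  case: (boolP (d %| m)%N) => // dm.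
  have := dvdn_leq m0 dm; have := dvdn_gt0 m0 dm; lia.
rewrite big_filter -[1%N]addn0 iotaDl big_map.
rewrite -[N in iota 0 N]subn0 -[iota 0 _]/(index_iota 0 N).
rewrite big_mkord big_mkcond.
by apply: eq_bigr => h _; rewrite add1n; case: dvdn; rewrite ?mul1n ?mul0n.
Qed.

Lemma coef_dlog_macmahon (R : comNzRingType) N k : (0 < k <= N)%N ->
  (\sum_(i < N) \sum_(j < N)
     'X^((i + j).+1) *+ (i + j).+1 * geo R N (i + j).+1)`_k = (sigma 2 k)%:R.
Proof.
move=> /[dup] k_bounds /andP[k0 kN]; rewrite (sigma_sum 2 k0 kN) coef_sum.
transitivity ((\sum_(i < N) \sum_(j < N)
    ((i + j).+1 %| k) * (i + j).+1)%N%:R : R).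
  rewrite natr_sum; apply: eq_bigr => i _; rewrite natr_sum coef_sum.
  by apply: eq_bigr => j _; rewrite coef_dlog_geo.
rewrite (@sum_antidiagonals _ (fun h => (h %| k) * h)%N) => [|h Nh].
  by congr _%:R; apply: eq_bigr => h _; rewrite mulnCA mulnn.
by rewrite gtnNdvd //; lia.
Qed.

Lemma coef_dlog_bell (F : numFieldType) N (s : nat -> F) k : (0 < k <= N)%N ->
  (\sum_(i < N)
     (i.+1%:R * (i`!%:R * s i.+1 / (i.+1)`!%:R)) *: 'X^(i.+1))`_k = s k.
Proof.
case: k => // k /andP[_ kN]; rewrite coef_sum.
rewrite (bigD1 (Ordinal kN)) //= coefZ coefXn eqxx mulr1 big1 ?addr0 => [|i ik].
  have f0 : k`!%:R != 0 :> F by rewrite pnatr_eq0 -lt0n fact_gt0.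
  have k0 : k.+1%:R != 0 :> F by rewrite pnatr_eq0.
  rewrite factS natrM; move: (k.+1%:R) (k`!%:R) k0 f0 => u v u0 v0.
  by field; rewrite u0 v0.
by rewrite coefZ coefXn eqSS eq_sym (negPf (ik : (i : nat) != k)) mulr0.
Qed.

Theorem theorem3 (n : nat) (n_gt0 : (0 < n)%N) :
  (PL n)%:R =
    complete_bell n (fun i : nat => (i.-1)`!%:R * (sigma 2 i)%:R) / n`!%:R
  :> rat.
Proof.
pose N := n.+1.
rewrite (@PL_coef N _ n) // (@complete_bell_expo _ n N) //.
pose L : {poly rat} :=
  \sum_(k < N) \sum_(j < N) 'X^((k + j).+1) *+ (k + j).+1 * geo _ N (k + j).+1.
pose M : {poly rat} := \sum_(i < N)
  (i.+1%:R * (i`!%:R * (sigma 2 i.+1)%:R / (i.+1)`!%:R)) *: 'X^(i.+1).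
apply: (@logder_unique _ N _ _ L M) => //.
- by apply: logder_prod => k _; apply: logder_prod => j _; apply: logder_geo.
- by apply: logder_prod => i _; apply: logder_expo.
case=> [|k] kN; last first.
  by rewrite coef_dlog_macmahon // (coef_dlog_bell (fun i => (sigma 2 i)%:R)).
rewrite !coef_sum !big1 // => i _; first by rewrite coefZ coefXn /= mulr0.
rewrite coef_sum big1 // => j _.
by rewrite coefM big_ord1 coefMn coefXn mul0rn mul0r.
Qed.
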